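(* Let $m$ and $d$ be positive integers. If $a$ and $b$ are nonnegative integers, then: (1) $a^{\langle d\rangle}+b^{\langle d\rangle}\leq (a+b)^{\langle d\rangle}$. (2) If, additionally, $\max(a,b)\leq\binom{m-1+d}{d}$ and $c$ is a positive integer such that $$a+b\leq \binom{m-1+d}{d}+c,$$ then $$a^{\langle d\rangle}+b^{\langle d\rangle}\leq \binom{m-1+d}{d}^{\langle d\rangle}+c^{\langle d\rangle}.$$
   Context: For nonnegative integers $p,q$, set $\binom{p}{q}=\frac{p!}{(p-q)!\,q!}$ if $p\geq q$ and $\binom{p}{q}=0$ if $p<q$. For all positive integers $a$ and $d$, there exist unique integers $k_d>k_{d-1}>\cdots>k_j\geq j\geq 1$ such that $$a=\binom{k_d}{d}+\binom{k_{d-1}}{d-1}+\cdots+\binom{k_j}{j}$$ (here $k_d$ is the largest integer with $a\geq\binom{k_d}{d}$); the sequence $k_d,\dots,k_j$ is called the (Macaulay) $d$-binomial representation of $a$. For each positive integer $d$, Macaulay's function $*^{\langle d\rangle}:\mathbb N\to\mathbb N$ (where $\mathbb N$ includes $0$) is defined by $$a^{\langle d\rangle}=\binom{k_d+1}{d+1}+\binom{k_{d-1}+1}{d}+\cdots+\binom{k_j+1}{j+1}$$ for $a>0$ with $d$-binomial representation $k_d,\dots,k_j$, and $0^{\langle d\rangle}=0$. *)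

(* Defs.v *)
From mathcomp Require Import all_boot.
Set Implicit Arguments.
Unset Strict Implicit.
Unset Printing Implicit Defensive.

(* [:: k_d; ...; k_j] is stored from k_d downwards: its item i is k_(d-i), and
   j = d - (size k).-1. *)
Definition is_binrep (d a : nat) (k : seq nat) : bool :=
  [&& 0 < size k <= d,
      sorted gtn k,
      d - (size k).-1 <= last 0 k
    & a == \sum_(i < size k) 'C(nth 0 k i, d - i)].

(* The largest k with 'C(k, d) <= a; such a k is less than a + d when 0 < d
   and 0 < a (see bin_topP). *)
Definition bin_top (d a : nat) : nat := \max_(k < a + d | 'C(k, d) <= a) k.

Fixpoint binrep (d a : nat) : seq nat :=
  if d is d'.+1 then
    if a == 0 then [::]
    else bin_top d a :: binrep d' (a - 'C(bin_top d a, d))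
  else [::].

(* binrep is [::] at a = 0, so macaulay d 0 is an empty sum. *)
Definition macaulay (d a : nat) : nat :=
  let k := binrep d a in \sum_(i < size k) 'C((nth 0 k i).+1, (d - i).+1).

Lemma ltn_bin_head n d : d <= n -> 'C(n, d.+1) < 'C(n.+1, d.+1).
Proof. by move=> le_dn; rewrite binS -[X in X < _]addn0 ltn_add2l bin_gt0. Qed.

Lemma leq_bin_add n d : 0 < d -> n < 'C(n, d) + d.
Proof.
case: d => // d _; elim: n => [|n IHn]; first by rewrite addnS.
have [lt_nd | le_dn] := ltnP n d; first by rewrite addnS ltnS (leq_trans lt_nd) ?leq_addl.
by apply: (leq_ltn_trans IHn); rewrite ltn_add2r ltn_bin_head.
Qed.

Lemma bin_topP d a k : 0 < d -> 0 < a ->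
  ('C(k, d) <= a) = (k <= bin_top d a).
Proof.
move=> d_gt0 a_gt0; apply/idP/idP => [le_ka | le_k].
  have lt_k : k < a + d by rewrite (leq_trans (leq_bin_add k d_gt0)) ?leq_add2r.
  exact: (leq_bigmax_cond (Ordinal lt_k)).
apply: leq_trans (leq_bin2l d le_k) _; rewrite /bin_top.
have lt0 : 0 < a + d by rewrite addn_gt0 a_gt0.
have P0 : 'C(Ordinal lt0, d) <= a by rewrite bin_small.
have nz : 0 < #|[pred i : 'I_(a + d) | 'C(i, d) <= a]|.
  by apply/card_gt0P; exists (Ordinal lt0).
by have [i Pi ->] := eq_bigmax_cond (fun i : 'I_(a + d) => val i) nz.
Qed.

Lemma is_binrep_cons d a x s :
  is_binrep d.+1 a (x :: s) =
  [&& d < x, 'C(x, d.+1) <= a &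
    if s is y :: _ then (y < x) && is_binrep d (a - 'C(x, d.+1)) s
    else a == 'C(x, d.+1)].
Proof.
rewrite /is_binrep /= big_ord_recl /= subn0 ltnS.
under eq_bigr => i _ do rewrite /bump /= add1n subSS.
case: s => [|y s].
  by rewrite /= big_ord0 addn0 subn0; case: eqP => [->|]; rewrite ?leqnn ?andbF.
set S := \sum_(i < _) _; rewrite /= subSS.
apply/and4P/idP => [[sz /andP[yx ps] lj /eqP ->]|].
  rewrite leq_addr addKn eqxx sz ps yx lj !andbT.
  have : last y s + size s <= y.
    elim: s y ps {sz lj yx S} => [|z s IHs] y /=; first by rewrite addn0.
    by case/andP=> zy /IHs le; rewrite addnS (leq_ltn_trans le).
  move=> le; apply: leq_ltn_trans yx; apply: leq_trans le.
  by rewrite addnC -leq_subLR.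
case/and5P=> lt_dx le_xa yx sz /and3P[ps lj /eqP eS].
by rewrite sz yx ps lj -eS subnKC.
Qed.

Lemma is_binrep_bounds d a x s :
  is_binrep d a (x :: s) -> 'C(x, d) <= a < 'C(x.+1, d).
Proof.
elim: d a x s => [|d IHd] a x s; first by [].
rewrite is_binrep_cons => /and3P[lt_dx le_xa]; rewrite le_xa /=.
case: s => [/eqP-> | y s /andP[lt_yx /IHd /andP[_ lt_a]]].
  by rewrite ltn_bin_head // ltnW.
rewrite binS -ltn_subLR //.
by rewrite (leq_trans lt_a) ?leq_bin2l.
Qed.

Lemma is_binrep_gt0 d a k : is_binrep d a k -> 0 < a.
Proof.
case: d k => [|d] [|x s] //; rewrite is_binrep_cons => /and3P[lt_dx le_xa _].
by rewrite (leq_trans _ le_xa) ?bin_gt0.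
Qed.

Lemma binrepP d a : 0 < d -> 0 < a -> is_binrep d a (binrep d a).
Proof.
elim: d a => // d IHd a _ a_gt0; rewrite /= eqn0Ngt a_gt0 /=.
set x := bin_top _ _; rewrite is_binrep_cons.
have le_xa : 'C(x, d.+1) <= a by rewrite bin_topP.
have lt_ax : a < 'C(x.+1, d.+1) by rewrite ltnNge bin_topP // ltnn.
have lt_dx : d < x by rewrite -bin_topP // binn.
have lt_r : a - 'C(x, d.+1) < 'C(x, d) by rewrite ltn_subLR // -binS.
rewrite lt_dx le_xa /=; set r := a - _ in lt_r *.
have [r0 | r_gt0] := posnP r.
  have -> : binrep d r = [::] by case: (d) => //= ?; rewrite r0.
  by rewrite eqn_leq le_xa andbT -subn_eq0 -/r r0.
have d_gt0 : 0 < d by case: (d) lt_r => //; rewrite bin0 ltnS leqNgt r_gt0.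
have := IHd r d_gt0 r_gt0; case: (binrep d r) => [|y s] rep //.
rewrite rep andbT ltnNge; apply/negP => le_xy.
have /andP[le_yr _] := is_binrep_bounds rep.
by have := leq_trans lt_r (leq_trans (leq_bin2l d le_xy) le_yr); rewrite ltnn.
Qed.

Lemma binrep_unique d a k : is_binrep d a k -> k = binrep d a.
Proof.
elim: d a k => [|d IHd] a [|x s] // rep.
have a_gt0 := is_binrep_gt0 rep; rewrite /= eqn0Ngt a_gt0 /=.
have /andP[le_xa lt_ax] := is_binrep_bounds rep.
have <- : x = bin_top d.+1 a.
  by apply/eqP; rewrite eqn_leq -bin_topP // le_xa leqNgt -bin_topP // -ltnNge.
congr (_ :: _); move: rep; rewrite is_binrep_cons le_xa.
case: s => [/and3P[_ _ /eqP->] | y s /and3P[_ _ /andP[_ /IHd]] //].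
by rewrite subnn; case: (d).
Qed.

Lemma macaulay0 d : macaulay d 0 = 0.
Proof. by case: d => [|d]; rewrite /macaulay /= big_ord0. Qed.

Lemma macaulayE d a k : is_binrep d a k ->
  macaulay d a = \sum_(i < size k) 'C((nth 0 k i).+1, (d - i).+1).
Proof. by move=> /binrep_unique->. Qed.

(* Main.v *)
Require Import Defs.
From mathcomp Require Import all_boot.
From mathcomp Require Import zify.

(** The theorem is about partial sums.  Let D_d be the sequence of increments
of Macaulay's function [macaulay d], so that [macaulay d a] is the sum of the
first a terms of D_d.  Reading the leading term off the binomial
representation shows that the terms of D_(d+1) at positions from C(k, d+1) to
C(k+1, d+1) - 1 are the first C(k, d) terms of D_d.  So, if W(k, d) denotes
the prefix of length C(k, d) of D_d, Pascal's rule lifts to words: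
  W(k+1, d+1) = W(k, d+1) ++ W(k, d).
For example D_1 = 1, 2, 3, ... and D_2 = 1, 1, 2, 1, 2, 3, ...; the rule also
holds at d = 0 if W(k, 0) is the one-letter word k+1.  [partial_sum k d] sums
the initial terms of W(k, d), and [macaulay_block] is the rule above.

Part (1) says that a prefix of D_d has the least sum among the windows of its
length ([prefix_minimal]).  Part (2) reduces to the dual fact that a suffix
of W(k, d) has the greatest sum among the windows of its length in W(k, d)
([suffix_maximal]): if a + b = C(k, d) + c, compare the window of positions
c, ..., b - 1 with the suffix starting at position a.

Both facts are proved by a joint induction on d, with two more facts that
compare D_(d+1) with D_d: a prefix of D_(d+1) weighs at most the prefix of D_d
of the same length ([prefix_decreasing]), because it is a concatenation of
prefixes of D_d; and a suffix of W(k, d+1) weighs at most the suffix of W(k, d)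
of the same length ([suffix_decreasing]).  Each induction step cuts windows at
the junction of W(k, d+1) and W(k, d). *)

(** * The block structure of Macaulay's function *)

(** The sum of the first a terms of W(k, d).  Only the degree 0 depends on k:
the slope k+1 is what makes the block rule hold from degree 0 to degree 1,
and it lets the inductions start at a linear function. *)
Definition partial_sum (k d a : nat) : nat :=
  if d is 0 then k.+1 * a else macaulay d a.

Lemma macaulay_block_lt d k r : r < 'C(k, d) ->
  macaulay d.+1 ('C(k, d.+1) + r) = 'C(k.+1, d.+2) + partial_sum k d r.
Proof.
move=> lt_r; have le_dk : d <= k by rewrite -bin_gt0 (leq_ltn_trans _ lt_r).
have [lt_dk | le_kd] := ltnP d k; last first.
  have kd : k = d by lia.
  move: lt_r; rewrite kd binn => lt_r; have -> : r = 0 by lia.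
  rewrite !bin_small // macaulay0 /partial_sum.
  by case: (d) => [|d']; rewrite ?muln0 ?macaulay0.
have a_gt0 : 0 < 'C(k, d.+1) + r by rewrite addn_gt0 bin_gt0 lt_dk.
have topE : bin_top d.+1 ('C(k, d.+1) + r) = k.
  apply/eqP; rewrite eqn_leq -bin_topP // leq_addr andbT leqNgt -bin_topP //.
  by rewrite binS leq_add2l -ltnNge.
rewrite {1}/macaulay /= addn_eq0 -addn_eq0 eqn0Ngt a_gt0 /= topE addKn.
rewrite big_ord_recl /= subn0; congr (_ + _).
case: d lt_r {le_dk lt_dk a_gt0 topE} => [|d] lt_r.
  move: lt_r; rewrite bin0 => lt_r; have -> : r = 0 by lia.
  by rewrite big_ord0 /partial_sum muln0.
by apply: eq_bigr => i _; rewrite /bump /= add1n subSS.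
Qed.

Lemma partial_sum_bin d k : partial_sum k d 'C(k, d) = 'C(k.+1, d.+1).
Proof.
case: d => [|d]; first by rewrite /= bin0 bin1 muln1.
have [le_kd | lt_dk] := leqP k d; first by rewrite !bin_small //= macaulay0.
have := macaulay_block_lt d k 0; rewrite bin_gt0 ltnW // !addn0 /= => -> //.
by case: (d) => [|d']; rewrite /= ?muln0 ?macaulay0 addn0.
Qed.

(** The rule W(k+1, d+1) = W(k, d+1) ++ W(k, d).  The right end r = C(k, d) is
the start of the next block, where the two expressions agree by Pascal. *)
Lemma macaulay_block d k r : r <= 'C(k, d) ->
  macaulay d.+1 ('C(k, d.+1) + r) = 'C(k.+1, d.+2) + partial_sum k d r.
Proof.
rewrite leq_eqVlt => /orP[/eqP->|]; last exact: macaulay_block_lt.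
by rewrite -binS -[LHS]/(partial_sum k.+1 d.+1 _) !partial_sum_bin -binS.
Qed.

Lemma macaulay_bin d k : macaulay d.+1 'C(k, d.+1) = 'C(k.+1, d.+2).
Proof. exact: (partial_sum_bin d.+1). Qed.

(** A nonempty prefix of D_(d+1) ends inside some block.  One that ends at a
junction is cut before the block that it completes, so that r > 0: this is what
makes C(k, d+1) < a in an induction on a. *)
Lemma block_decomposition d a : 0 < a ->
  exists k r, [/\ a = 'C(k, d.+1) + r, 0 < r & r <= 'C(k, d)].
Proof.
move=> a_gt0; have ex_k : exists k, a <= 'C(k, d.+1).
  by exists (a + d.+1); have := leq_bin_add (a + d.+1) (ltn0Sn d); lia.
case: (ex_minnP ex_k) => [[|k] le_a min_k]; first by rewrite bin0n in le_a; lia.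
have lt_a : 'C(k, d.+1) < a by rewrite ltnNge; apply/negP=> /min_k; rewrite ltnn.
by exists k, (a - 'C(k, d.+1)); rewrite binS in le_a; split; lia.
Qed.

(** * The four properties of the joint induction *)

Definition prefix_minimal d := forall k a b,
  partial_sum k d a + partial_sum k d b <= partial_sum k d (a + b).

(** The window from c to b against the suffix from a, of equal lengths
b - c = C(k, d) - a. *)
Definition suffix_maximal d := forall k a b c,
  a <= 'C(k, d) -> b <= 'C(k, d) -> a + b = 'C(k, d) + c ->
  partial_sum k d a + partial_sum k d b <= 'C(k.+1, d.+1) + partial_sum k d c.

Definition prefix_decreasing d := forall k a,
  a <= 'C(k, d) -> macaulay d.+1 a <= partial_sum k d a.

(** The suffixes of W(k, d+1) and W(k, d) that start at u and v have the same
length; the sums of these words are C(k+1, d+2) and C(k+1, d+1). *)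
Definition suffix_decreasing d := forall k u v,
  u <= 'C(k, d.+1) -> v <= 'C(k, d) -> u + 'C(k, d) = v + 'C(k, d.+1) ->
  'C(k.+1, d.+2) + partial_sum k d v <= 'C(k.+1, d.+1) + macaulay d.+1 u.

Lemma suffix_maximal0 : suffix_maximal 0.
Proof.
by move=> k a b c _ _; rewrite bin0 bin1 /= -mulnDr => ->; rewrite mulnDr muln1.
Qed.

Lemma prefix_decreasing0 : prefix_decreasing 0.
Proof.
move=> k a; rewrite bin0 /partial_sum; case: a => [|[|a]] // _.
  by rewrite macaulay0.
by have -> : macaulay 1 1 = 1 := macaulay_bin 0 1; rewrite muln1.
Qed.

Lemma suffix_decreasing0 : suffix_decreasing 0.
Proof.
move=> k u v; rewrite bin0 !bin1 => le_u le_v uvE.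
have -> : macaulay 1 u = 'C(u.+1, 2) by rewrite -[u in LHS]bin1 macaulay_bin.
case: v le_v uvE => [|[|v]] //= _ uvE; last first.
  by have -> : u = k; lia.
by have -> : k = u.+1; [lia | rewrite (binS u.+1 1) bin1; lia].
Qed.

(** Unimodality of the binomial coefficients, in the form in which it
ensures that W(k, d+1) is long enough to have a suffix of any length for which
W(k, d) and W(k, d+2) both have one. *)
Lemma min_bin_neighbours k e : minn 'C(k, e) 'C(k, e.+2) <= 'C(k, e.+1).
Proof.
have E1 := mul_bin_left k e; have E2 := mul_bin_left k e.+1.
have [le_e | lt_e] := leqP e.+1 (k - e).
  have : e.+1 * 'C(k, e) <= e.+1 * 'C(k, e.+1) by rewrite E1 leq_mul2r le_e orbT.
  by rewrite leq_pmul2l //; lia.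
have : e.+2 * 'C(k, e.+2) <= e.+2 * 'C(k, e.+1).
  by rewrite E2 leq_mul2r; apply/orP; right; lia.
by rewrite leq_pmul2l //; lia.
Qed.

Section Step.

Variable d : nat.
Hypotheses (Pmin : prefix_minimal d) (Smax : suffix_maximal d).
Hypotheses (Pdec : prefix_decreasing d) (Sdec : suffix_decreasing d).

(** Case of a suffix contained in the last block W(k, d) of W(k+1, d+1),
starting at position x of that block.  The competing window lies in this block
(by [Smax]), or straddles its left end, or lies in W(k, d+1).  In the second
case the part on the left weighs at most a suffix of W(k, d) by [Sdec], and the
part on the right, a prefix of W(k, d), at most the window that precedes that
suffix.  In the third, the window weighs at most a suffix of W(k, d+1), to which
[Sdec] applies. *)
Lemma last_block_suffix_maximal k x b c :
  (forall a' b' c', a' <= 'C(k, d.+1) -> b' <= 'C(k, d.+1) ->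
     a' + b' = 'C(k, d.+1) + c' ->
     macaulay d.+1 a' + macaulay d.+1 b' <= 'C(k.+1, d.+2) + macaulay d.+1 c') ->
  x <= 'C(k, d) -> b <= 'C(k.+1, d.+1) -> b + x = c + 'C(k, d) ->
  partial_sum k d x + macaulay d.+1 b <= 'C(k.+1, d.+1) + macaulay d.+1 c.
Proof.
move=> IHk le_x; rewrite [X in b <= X]binS => le_b bxE.
have [le_c | lt_c] := leqP 'C(k, d.+1) c.
  have bE : b = 'C(k, d.+1) + (b - 'C(k, d.+1)) by lia.
  have cE : c = 'C(k, d.+1) + (c - 'C(k, d.+1)) by lia.
  rewrite bE cE !macaulay_block; [| lia ..].
  have := Smax k x (b - 'C(k, d.+1)) (c - 'C(k, d.+1)); lia.
have [le_Nb | lt_b] := leqP 'C(k, d.+1) b.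
  have bE : b = 'C(k, d.+1) + (b - 'C(k, d.+1)) by lia.
  rewrite bE macaulay_block; last lia.
  have := Sdec k c (x + (b - 'C(k, d.+1))).
  have := Pmin k x (b - 'C(k, d.+1)); lia.
have := IHk ('C(k, d.+1) - (b - c)) b c.
have := Sdec k ('C(k, d.+1) - (b - c)) x; lia.
Qed.

Lemma suffix_maximalS : suffix_maximal d.+1.
Proof.
rewrite /suffix_maximal /partial_sum; elim=> [|k IHk] a b c le_a le_b abE.
  by move: le_a le_b; rewrite bin0n /= !leqn0 => /eqP-> /eqP->; rewrite macaulay0.
have last_block := last_block_suffix_maximal k _ _ _ IHk.
have CE := binS k d; have C'E := binS k.+1 d.+1.
wlog le_ba : a b le_a le_b abE / b <= a.
  move=> wlog_ba; have [/wlog_ba|/ltnW/wlog_ba] := leqP b a; first exact.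
  by rewrite [macaulay _ b + _]addnC; apply; rewrite 1?addnC.
have [le_Na | lt_aN] := leqP 'C(k, d.+1) a.
  have aE : a = 'C(k, d.+1) + (a - 'C(k, d.+1)) by lia.
  rewrite aE macaulay_block; last lia.
  have := last_block (a - 'C(k, d.+1)) b c; lia.
(* The suffix from a is a suffix of W(k, d+1) and the whole last block. Split
   the window at c + C(k, d) to match: its right part is compared with the
   former, its left part with the latter. *)
have := IHk a b ('C(k, d) + c).
have := last_block 0 ('C(k, d) + c) c; lia.
Qed.

(** The prefix of length a + b is W(k, d+1) followed by a nonempty prefix of
W(k, d), of length r.  If a and b are at most the length of W(k, d+1), then the
maximality of suffixes in this word leaves the prefix of length r of D_(d+1) to
be compared with that of D_d.  Otherwise the longer of the two contains
W(k, d+1); without this common part, and with the shorter prefix replaced by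
the heavier one of D_d, the claim is [Pmin]. *)
Lemma prefix_minimalS : prefix_minimal d.+1.
Proof.
rewrite /prefix_minimal /partial_sum => _ a b.
have [/eqP | ab_gt0] := posnP (a + b).
  by rewrite addn_eq0 => /andP[/eqP-> /eqP->]; rewrite macaulay0.
wlog le_ba : a b ab_gt0 / b <= a.
  move=> wlog_ba; have [/wlog_ba|/ltnW/wlog_ba] := leqP b a; first exact.
  by rewrite [b + a]addnC [macaulay _ b + _]addnC; apply.
have [k [r [abE r_gt0 le_r]]] := block_decomposition d _ ab_gt0.
rewrite abE macaulay_block //.
have [le_a | lt_a] := leqP a 'C(k, d.+1).
  have := suffix_maximalS k a b r; have := Pdec k r; rewrite /partial_sum; lia.
have aE : a = 'C(k, d.+1) + (a - 'C(k, d.+1)) by lia.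
rewrite aE macaulay_block; last lia.
have := Pdec k b; have := Pmin k (a - 'C(k, d.+1)) b.
by have -> : a - 'C(k, d.+1) + b = r; lia.
Qed.

(** D_(d+2) is a concatenation of prefixes of D_(d+1), so this iterates
[prefix_minimalS]. *)
Lemma prefix_decreasingS : prefix_decreasing d.+1.
Proof.
move=> k a _; rewrite /partial_sum; elim/ltn_ind: a => a IHa {k}.
have [-> | a_gt0] := posnP a; first by rewrite !macaulay0.
have [k [r [aE r_gt0 le_r]]] := block_decomposition d.+1 _ a_gt0.
have := IHa 'C(k, d.+2); rewrite aE macaulay_block // macaulay_bin.
have := prefix_minimalS k 'C(k, d.+2) r; rewrite /partial_sum; lia.
Qed.

(** A suffix inside the last block W(k, d+1) of W(k+1, d+2) is a window of
W(k+1, d+1), so [suffix_maximalS] applies.  A longer one is all of W(k, d+1)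
after a suffix of W(k, d+2), which weighs at most a suffix of W(k, d+1) by
induction, hence at most one of W(k, d) by [Sdec].  As W(k+1, d+1) is the
concatenation of W(k, d+1) and W(k, d), it remains to compare the prefixes of
length v that are left out: by [Pdec], that of W(k, d) is the heavier. *)
Lemma suffix_decreasingS : suffix_decreasing d.+1.
Proof.
elim=> [|k IHk] u v le_u le_v uvE.
  move: le_v; rewrite [X in _ <= X]bin0n /= leqn0 => /eqP->.
  by rewrite /= macaulay0 bin_small.
have E1 := binS k d; have E2 := binS k d.+1.
have E3 := binS k.+1 d.+2; have E4 := binS k.+1 d.+1.
have [le_Nu | lt_u] := leqP 'C(k, d.+2) u.
  have uE : u = 'C(k, d.+2) + (u - 'C(k, d.+2)) by lia.
  rewrite uE macaulay_block; last lia.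
  have := suffix_maximalS k.+1 'C(k, d.+1) v (u - 'C(k, d.+2)).
  rewrite /partial_sum macaulay_bin; lia.
have := min_bin_neighbours k d.
set w := 'C(k, d.+1) - ('C(k, d.+2) - u) => le_min.
have := IHk u w; have := Sdec k w v; have := Pdec k v.
rewrite /partial_sum; lia.
Qed.

End Step.

Lemma macaulay_windows d :
  [/\ prefix_minimal d, suffix_maximal d, prefix_decreasing d
    & suffix_decreasing d].
Proof.
elim: d => [|d [Pmin Smax Pdec Sdec]].
  split; [by move=> k a b; rewrite /= mulnDr | exact: suffix_maximal0 | |].
    exact: prefix_decreasing0.
  exact: suffix_decreasing0.
split; [exact: prefix_minimalS | exact: suffix_maximalS | |].
  exact: prefix_decreasingS.
exact: suffix_decreasingS.
Qed.

(** * Macaulay's function on sums *)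

Lemma macaulay_superadditive d a b :
  macaulay d.+1 a + macaulay d.+1 b <= macaulay d.+1 (a + b).
Proof. by have [Pmin _ _ _] := macaulay_windows d.+1; apply: (Pmin 0). Qed.

Lemma leq_macaulay d a b : a <= b -> macaulay d.+1 a <= macaulay d.+1 b.
Proof.
by move=> le_ab; have := macaulay_superadditive d a (b - a); rewrite subnKC //; lia.
Qed.

(** Monotonicity reduces the hypothesis to the equality a + b = C(k, d+1) + c,
where suffixes are maximal, unless a + b is at most C(k, d+1), where
superadditivity suffices. *)
Lemma leq_macaulay_bin d k a b c :
  a <= 'C(k, d.+1) -> b <= 'C(k, d.+1) -> a + b <= 'C(k, d.+1) + c ->
  macaulay d.+1 a + macaulay d.+1 b
    <= macaulay d.+1 'C(k, d.+1) + macaulay d.+1 c.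
Proof.
move=> le_a le_b le_ab; have [le_abN | lt_N] := leqP (a + b) 'C(k, d.+1).
  have := macaulay_superadditive d a b; have := leq_macaulay d _ _ le_abN; lia.
have [_ Smax _ _] := macaulay_windows d.+1.
have := Smax k a b (a + b - 'C(k, d.+1)); rewrite macaulay_bin /partial_sum.
have := leq_macaulay d (a + b - 'C(k, d.+1)) c; lia.
Qed.

Theorem lemma0p2 (m d a b : nat) (hm : 0 < m) (hd : 0 < d) :
  macaulay d a + macaulay d b <= macaulay d (a + b)
  /\ (forall c : nat, 0 < c ->
        maxn a b <= 'C(m - 1 + d, d) ->
        a + b <= 'C(m - 1 + d, d) + c ->
        macaulay d a + macaulay d b
          <= macaulay d 'C(m - 1 + d, d) + macaulay d c).
Proof.
case: d hd => // d _; split=> [|c _]; first exact: macaulay_superadditive.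
rewrite geq_max => /andP[le_a le_b]; exact: leq_macaulay_bin.
Qed.
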